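(* For every integer $k$ there is an Eulerian planar triangulation $G$ together with a proper $3$-colouring of its vertices such that, for every permeating subtree $T$ of $G$ and every one of the three colour classes $A \subseteq V(G)$, at least $k$ vertices of $A$ belong to $T$ and at least $k$ vertices of $A$ do not belong to $T$.
   Context: A planar triangulation is a finite simple graph with at least $4$ vertices, embedded in the plane (equivalently the sphere), in which every face, including the outer face, is bounded by a $3$-cycle. It is Eulerian if every vertex has even degree. A subgraph $H$ of a planar triangulation $G$ permeates $G$ if $H$ is an induced subgraph of $G$ and every face of $G$ (including the outer face) is incident to some vertex of $H$. A permeating subtree of $G$ is a subgraph that permeates $G$ and is a tree (connected and acyclic). *)

(* Defs.v *)
From HB Require Import structures.
From mathcomp Require Import all_boot all_order all_fingroup all_algebra.

Set Implicit Arguments.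
Unset Strict Implicit.
Unset Printing Implicit Defensive.

Structure sgraph := SGraph {
  vertex :> finType;
  adj : rel vertex;
  adj_sym : symmetric adj;
  adj_irr : irreflexive adj }.

Definition edges (G : sgraph) : {set {set G}} :=
  [set [set p.1; p.2] | p : G * G & adj p.1 p.2].

Definition connected_on (V : finType) (S : {set V}) (e : rel V) : Prop :=
  S != set0 /\ {in S &, forall u v, connect e u v}.

(* The dart (u, v) is the edge uv directed from u to v. *)
Definition dart (G : sgraph) := {p : G * G | adj p.1 p.2}.
Definition tail (G : sgraph) (d : dart G) : G := (val d).1.
Definition head (G : sgraph) (d : dart G) : G := (val d).2.

Lemma rev_subproof (G : sgraph) (d : dart G) : adj (head d) (tail d).
Proof. by rewrite adj_sym; exact: (valP d). Qed.

Definition rev (G : sgraph) (d : dart G) : dart G :=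
  exist _ (head d, tail d) (rev_subproof d).

Lemma revK (G : sgraph) : involutive (@rev G).
Proof. by move=> d; apply: val_inj; case: d => -[]. Qed.

Definition rev_perm (G : sgraph) : {perm dart G} := perm (inv_inj (@revK G)).

(* A cellular embedding of a connected graph in an oriented closed surface is
   determined, up to homeomorphism, by a rotation system, and every rotation
   system arises in this way (Heffter, Edmonds): it is a permutation of the
   darts which cyclically permutes the darts leaving each vertex, giving their
   clockwise order in the drawing.  Every embedding of a connected graph in the
   sphere is cellular. *)
Definition rotation_system (G : sgraph) (rot : {perm dart G}) : Prop :=
  forall d d' : dart G, (d' \in porbit rot d) = (tail d' == tail d).

(* After traversing (u, v), the boundary walk of the face on a fixed side of
   that dart continues with the dart that follows (v, u) around v.  A face is
   represented by the set of darts of its boundary walk; no face is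
   distinguished, so the outer face is one of them. *)
Definition faces (G : sgraph) (rot : {perm dart G}) : {set {set dart G}} :=
  porbits (rev_perm G * rot)%g.

(* The surface is the sphere exactly when its Euler characteristic is 2. *)
Definition plane_embedding (G : sgraph) (rot : {perm dart G}) : Prop :=
  [/\ connected_on [set: G] (@adj G),
      rotation_system rot &
      #|G| + #|faces rot| = #|edges G| + 2].

Definition incident (G : sgraph) (v : G) (F : {set dart G}) : Prop :=
  exists2 d, d \in F & tail d = v.

Definition bounded_by_3cycle (G : sgraph) (F : {set dart G}) : Prop :=
  exists u v w : G, uniq [:: u; v; w] /\
    [set val d | d in F] = [set (u, v); (v, w); (w, u)].

Structure planar_triangulation := PlanarTriangulation {
  graph_of :> sgraph;
  rotation : {perm dart graph_of};
  card_ge4 : 4 <= #|graph_of|;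
  embedded : plane_embedding rotation;
  triangular : forall F, F \in faces rotation -> bounded_by_3cycle F }.

Definition eulerian (G : sgraph) : Prop :=
  forall v : G, ~~ odd #|[set u | adj v u]|.

Definition proper_colouring (G : sgraph) (n : nat) (col : G -> 'I_n) : Prop :=
  forall u v : G, adj u v -> col u != col v.

Definition colour_class (G : sgraph) (n : nat) (col : G -> 'I_n) (i : 'I_n) :
  {set G} := [set v | col v == i].

Structure subgraph (G : sgraph) := Subgraph {
  sverts : {set G};
  sadj : rel G;
  sadj_sym : symmetric sadj;
  sadj_sub : forall u v, sadj u v -> [&& u \in sverts, v \in sverts & adj u v] }.

Definition induced (G : sgraph) (H : subgraph G) : Prop :=
  {in sverts H &, forall u v, adj u v -> sadj H u v}.

Definition permeates (G : planar_triangulation) (H : subgraph G) : Prop :=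
  induced H /\
  forall F, F \in faces (rotation G) ->
    exists2 v, v \in sverts H & incident v F.

(* [ucycle] also accepts [::], [:: x] and [:: x; y], which are not cycles of a
   simple graph. *)
Definition acyclic (G : sgraph) (H : subgraph G) : Prop :=
  forall c : seq G, ucycle (sadj H) c -> size c <= 2.

Definition tree (G : sgraph) (H : subgraph G) : Prop :=
  connected_on (sverts H) (sadj H) /\ acyclic H.

Definition permeating_subtree (G : planar_triangulation) (T : subgraph G) :
  Prop := permeates T /\ tree T.

(* Main.v *)
Require Import Defs.
From HB Require Import structures.
From mathcomp Require Import all_boot all_order all_fingroup all_algebra.
From mathcomp Require Import zify.

(* Let H be the tetrakis hexahedron: the cube with a pole of degree 4 inserted
   in every face.  It is an Eulerian triangulation, coloured by the six poles
   and the two classes of cube corners.  No permeating subtree T of H avoids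
   all poles: the corners outside T would form an independent set X, and T would
   have 8 - |X| vertices and 12 - 3|X| edges, so that 2|X| = 5.  Nor does T
   contain all poles: its corners would form an independent set Y, and T would
   have 6 + |Y| vertices and 3|Y| edges, so that 2|Y| = 5.
   Glue many copies of H into a chain along triangles, with the colours rotated
   from each copy to the next, so that every colour is the pole colour of a
   third of the copies.  An acyclic T meets each separating triangle in at most
   two adjacent vertices, so the part of T in a copy is still connected and the
   argument applies to every copy. *)

Set Implicit Arguments.
Unset Strict Implicit.
Unset Printing Implicit Defensive.

(** * Triangulations from cyclic neighbour lists *)

Lemma card_fibres (T U : finType) (f : T -> U) (A : {pred T}) n :
  (forall x, x \in A -> #|[set y in A | f y == f x]| = n) ->
  #|A| = #|f @: A| * n.
Proof.
move=> fib; rewrite -sum1_card (partition_big_imset f) /= -sum_nat_const.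
apply: eq_bigr => _ /imsetP[x Ax ->]; rewrite -[RHS](fib x Ax) -sum1_card.
by apply: eq_bigl => y; rewrite !inE.
Qed.

Section RotationLists.
Variables (V : finType) (N : V -> seq V).
Hypothesis N_uniq : forall a, uniq (N a).
Hypothesis N_sym : forall a b, b \in N a -> a \in N b.
Hypothesis N_irr : forall a, a \notin N a.
(* The face after the dart from b to a has [next (N a) b] as its third corner. *)
Hypothesis N_tri : forall a b, b \in N a -> next (N (next (N a) b)) a = b.

Lemma N_symE : symmetric (fun a b => b \in N a).
Proof. by move=> a b; apply/idP/idP; apply: N_sym. Qed.

Lemma N_irrE : irreflexive (fun a b => b \in N a).
Proof. by move=> a; apply/negbTE/N_irr. Qed.

Definition list_graph := SGraph N_symE N_irrE.
Local Notation G := list_graph.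

Lemma head_mem (d : dart G) : Defs.head d \in N (tail d).
Proof. exact: (valP d). Qed.

Lemma turn_subproof (d : dart G) :
  adj (tail d) (next (N (tail d)) (Defs.head d) : G).
Proof. by rewrite /= mem_next head_mem. Qed.

Definition turn (d : dart G) : dart G :=
  exist _ (tail d, next (N (tail d)) (Defs.head d) : G) (turn_subproof d).

Lemma dart_eq (d d' : dart G) : tail d = tail d' -> Defs.head d = Defs.head d' -> d = d'.
Proof.
by case: d d' => [[a b] ab] [[a' b'] ab'] /= E E'; apply: val_inj; congr pair.
Qed.

Lemma turn_inj : injective turn.
Proof.
move=> d d' E; have Et : tail d = tail d' by exact: (congr1 (@tail G) E).
have /= := congr1 (@Defs.head G) E.
rewrite /Defs.head /= -!/(Defs.head _) -Et => Eh; apply: dart_eq => //.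
rewrite -(prev_next (N_uniq (tail d)) (Defs.head d)) Eh.
by rewrite prev_next.
Qed.

Definition list_rotation : {perm dart G} := perm turn_inj.
Local Notation rot := list_rotation.

(** [next] runs through a duplicate-free list in a single cycle, so iterating [turn] reaches every
    dart with the same tail. *)
Lemma list_rotationP : rotation_system rot.
Proof.
move=> d d'; apply/idP/eqP => [|Et].
  case/porbitP=> n ->; elim: n => [|n IHn]; first by rewrite expg0 perm1.
  by rewrite expgSr permM permE -IHn.
have iterE n : Defs.head (iter n turn d) = iter n (next (N (tail d))) (Defs.head d)
     /\ tail (iter n turn d) = tail d.
  by elim: n => //= n [<- Etl]; rewrite /Defs.head /tail /= -/(tail _) Etl.
have : fconnect (next (N (tail d))) (Defs.head d) (Defs.head d').
  by rewrite (fconnect_cycle (cycle_next (N_uniq _))) ?head_mem // -Et head_mem.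
move/iter_findex=> Eh.
apply/porbitP; exists (findex (next (N (tail d))) (Defs.head d) (Defs.head d')).
rewrite permX (eq_iter (permE _)).
by apply: dart_eq; rewrite ?(iterE _).1 ?(iterE _).2.
Qed.

Definition face_step : {perm dart G} := (rev_perm G * rot)%g.

Lemma face_stepE d : (tail (face_step d) = Defs.head d) *
  (Defs.head (face_step d) = next (N (Defs.head d)) (tail d)).
Proof. by rewrite permM !permE. Qed.

Lemma face_step2_head d : Defs.head (face_step (face_step d)) = tail d.
Proof. by rewrite !face_stepE N_tri // N_sym // head_mem. Qed.

(** By [N_tri] the third dart of a face walk leads back to the tail of the first. *)
Lemma face_step3 d : face_step (face_step (face_step d)) = d.
Proof.
apply: dart_eq; first by rewrite (face_stepE _).1 face_step2_head.
by rewrite face_step2_head (face_stepE _).1.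
Qed.

Lemma face_stepP d d' : d' \in porbit face_step d ->
  exists2 i, i < 3 & d' = iter i face_step d.
Proof.
case/porbitP=> n ->; exists (n %% 3); first by rewrite ltn_mod.
rewrite permX {1}(divn_eq n 3) addnC iterD; congr iter.
elim: (n %/ 3) => // q IHq.
by rewrite mulSn addnC iterD /= face_step3.
Qed.

Lemma face_walkE d : porbit face_step d =
  [set d; face_step d; face_step (face_step d)].
Proof.
apply/setP=> d'; rewrite !inE; apply/idP/idP.
  by case/face_stepP=> -[|[|[|//]]] _ ->; rewrite /= eqxx ?orbT.
rewrite -orbA; case/or3P=> /eqP ->; first exact: porbit_id.
  exact: (mem_porbit _ 1).
by have := mem_porbit face_step 2 d; rewrite expgS expg1 permM.
Qed.

Lemma dart_neq (d : dart G) : tail d != Defs.head d.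
Proof.
by apply/negP=> /eqP E; have := valP d; rewrite /= -/(tail d) E (negbTE (N_irr _)).
Qed.

Lemma face_corners_uniq d :
  uniq [:: tail d; Defs.head d; Defs.head (face_step d)].
Proof.
have := dart_neq (face_step (face_step d)); have := dart_neq (face_step d).
have := dart_neq d.
rewrite face_step2_head (face_stepE (face_step d)).1 (face_stepE d).1 /=.
by rewrite !inE negb_or [_ == tail d]eq_sym => -> -> ->.
Qed.

Lemma list_faces_triangular F : F \in faces rot -> bounded_by_3cycle F.
Proof.
case/imsetP=> d _ ->.
exists (tail d), (Defs.head d), (Defs.head (face_step d)).
split; first exact: face_corners_uniq.
rewrite -/face_step face_walkE !imsetU !imset_set1.
have vE (e : dart G) : val e = (tail e, Defs.head e)
  by rewrite /tail /Defs.head; case: (val e).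
by rewrite !vE face_step2_head !(face_stepE (face_step d)).1 !(face_stepE d).1.
Qed.

Lemma incident_face d v : incident v (porbit face_step d) ->
  v \in [:: tail d; Defs.head d; next (N (Defs.head d)) (tail d)].
Proof.
case=> e; rewrite face_walkE !inE -orbA => /or3P[] /eqP -> <-;
by rewrite ?face_stepE eqxx ?orbT.
Qed.

Lemma card_faces : #|{: dart G}| = #|faces rot| * 3.
Proof.
apply: card_fibres => d _.
transitivity #|porbit face_step d|.
  by apply: eq_card => e; rewrite !inE eq_porbit_mem.
have := face_corners_uniq d; rewrite face_walkE.
have := face_stepE d; have := face_stepE (face_step d).
set d1 := face_step d; set d2 := face_step d1 => E2 E1.
rewrite -E2.1 -E1.1 /= !inE negb_or => /andP[/andP[n01 n02] /andP[n12 _]].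
rewrite -setUA cardsU1 cards2 !inE negb_or.
have dn (e e' : dart G) : tail e != tail e' -> e != e'.
  by apply: contraNneq => ->.
by rewrite !dn.
Qed.

Lemma card_darts : #|{: dart G}| = \sum_a size (N a).
Proof.
rewrite card_sig -sum1_card.
rewrite (eq_bigr (fun a => \sum_(b in N a) 1)); last first.
  by move=> a _; rewrite sum1_card; apply/esym/card_uniqP.
by rewrite pair_big_dep; apply: eq_bigl => p; rewrite unfold_in.
Qed.

Lemma card_edges : #|{: dart G}| = #|edges G| * 2.
Proof.
pose ends (d : dart G) : {set G} := [set tail d; Defs.head d].
have -> : edges G = ends @: {: dart G}.
  apply/setP=> E; apply/imsetP/imsetP => [[p] /[!inE] pA ->|[d _ ->]].
    by exists (exist _ p pA : dart G); rewrite ?inE.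
  by exists (val d); rewrite // inE; exact: (valP d).
apply: card_fibres => d _.
rewrite -[RHS](_ : #|[set d; Defs.rev d]| = 2); last first.
  rewrite cards2; case: eqP => // /(congr1 (@tail G)) /= /eqP.
  by rewrite {2}/tail /= (negbTE (dart_neq d)).
apply: eq_card => e; rewrite !inE /=; apply/eqP/orP; last first.
  by case=> /eqP -> //; rewrite /ends setUC.
move=> E; have n := dart_neq e.
have : tail e \in ends d by rewrite -E !inE eqxx.
have : Defs.head e \in ends d by rewrite -E !inE eqxx orbT.
rewrite !inE => /orP[] /eqP Eh /orP[] /eqP Et; rewrite ?Eh ?Et ?eqxx // in n.
  by right; apply/eqP/dart_eq.
by left; apply/eqP/dart_eq.
Qed.

(** The number D of darts is twice the number of edges and three times the number of faces, so Euler
    characteristic 2 amounts to D = 6 V - 12. *)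
Lemma list_plane_embedding :
    (forall a b, connect (fun a b => b \in N a) a b) ->
    \sum_a size (N a) + 12 = 6 * #|V| ->
  plane_embedding rot.
Proof.
move=> Nc szN; split; last 1 first.
- have := card_faces; have := card_edges.
  by rewrite card_darts -[#|list_graph|]/#|V|; lia.
- split=> [|u v _ _]; last exact: Nc.
  by rewrite -card_gt0 cardsT -[#|list_graph|]/#|V|; lia.
- exact: list_rotationP.
Qed.
End RotationLists.

(** * A chain of tetrakis hexahedra *)

(* Vertices 0, 7, 8, 9, 10, 13 are the poles.  The faces 0 1 2 and 13 12 11 are
   the ones along which copies are glued; the lists of their vertices start and
   end inside these faces. *)
Definition tetrakis : seq (seq nat) :=
  [:: [:: 1; 6; 4; 2]; [:: 2; 7; 3; 10; 6; 0]; [:: 0; 4; 9; 11; 7; 1];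
      [:: 7; 11; 13; 5; 10; 1]; [:: 12; 9; 2; 0; 6; 8];
      [:: 3; 13; 12; 8; 6; 10]; [:: 10; 5; 8; 4; 0; 1];
      [:: 11; 3; 1; 2]; [:: 5; 12; 4; 6]; [:: 12; 11; 2; 4]; [:: 3; 5; 6; 1];
      [:: 13; 3; 7; 2; 9; 12]; [:: 11; 9; 4; 8; 5; 13]; [:: 12; 5; 3; 11]].

(** The default [[::]] matters: [chain_link] uses [link (11 + r)], which is empty unless [r < 3], so
    only glued vertices get neighbours from the preceding copy. *)
Definition link j : seq nat := nth [::] tetrakis j.

(* Vertex j of copy i is numbered 11 i + j, so that the vertices 11, 12, 13 of a
   copy are the vertices 0, 1, 2 of the next one.  At such a shared vertex [undup]
   splices the two lists, which have their first and last entries in common. *)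
Definition chain_link m a : seq nat :=
  let q := a %/ 11 in let r := a %% 11 in
  undup ((if q == 0 then [::] else map (addn (11 * q.-1)) (link (11 + r))) ++
         (if q == m then [::] else map (addn (11 * q)) (link r))).

(** The table gives the poles of copy 0 colour 0, and [a %/ 11] rotates the colours by one per copy.
    Pole 13 is vertex 2 of the next copy and gets 2 + 1 = 0 modulo 3, as the other poles do. *)
Definition chain_colour a : nat :=
  (nth 0 [:: 0; 1; 2; 2; 1; 1; 2; 0; 0; 0; 0] (a %% 11) + a %/ 11) %% 3.

(** * Translation invariance and local properties of the chain *)

Lemma chain_link_shift m a : 11 <= a ->
  chain_link m.+1 (a + 11) = map (addn 11) (chain_link m a).
Proof.
move=> a11; rewrite /chain_link.
have -> : (a + 11) %/ 11 = (a %/ 11).+1 by lia.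
have -> : (a + 11) %% 11 = a %% 11 by lia.
have [q ->] : exists q, a %/ 11 = q.+1 by exists (a %/ 11).-1; lia.
rewrite -undup_map_inj; last exact: addnI.
congr undup; rewrite map_cat eqSS /=; congr cat.
  by rewrite -map_comp; apply: eq_map => x /=; lia.
by case: eqP => // _; rewrite -map_comp; apply: eq_map => x /=; lia.
Qed.

Lemma chain_link_widen m a : a < 11 * m -> chain_link m.+1 a = chain_link m a.
Proof.
move=> am; rewrite /chain_link.
by rewrite [_ == m.+1](_ : _ = false) 1?[_ == m](_ : _ = false) //; lia.
Qed.

Lemma link_lt14 j b : b \in link j -> b < 14.
Proof.
have [j14|] := ltnP j 14; last by move=> ?; rewrite /link nth_default.
have /allP/(_ j) : all (fun j => all (ltn^~ 14) (link j)) (iota 0 14).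
  by vm_compute.
by rewrite mem_iota => /(_ j14)/allP; apply.
Qed.

Lemma chain_link_range m a b : b \in chain_link m a -> a <= b + 21 /\ b <= a + 13.
Proof.
rewrite mem_undup mem_cat => /orP[]; case: ifP => // _ /mapP[x /link_lt14]; lia.
Qed.

(** The bound [11 * (a %/ 11) + 14] on neighbours makes the glued triangles separating; the smaller
    neighbour of each nonzero vertex gives connectedness by descent to 0. *)
Definition locally_sound m a :=
  [&& all (fun b => [&& b < 11 * m + 3, b != a, a \in chain_link m b,
             next (chain_link m (next (chain_link m a) b)) a == b,
             chain_colour b != chain_colour a & b < 11 * (a %/ 11) + 14])
          (chain_link m a),
      ~~ odd (size (chain_link m a)) &
      (a == 0) || has (ltn^~ a) (chain_link m a)].

Lemma chain_colour_shift a b :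
  (chain_colour (b + 11) == chain_colour (a + 11)) =
  (chain_colour b == chain_colour a).
Proof.
have Ed x : (x + 11) %/ 11 = (x %/ 11).+1 by lia.
by rewrite /chain_colour !modnDr !Ed !addnS -[_.+1]addn1 -[in eqbRHS]addn1 eqn_modDr.
Qed.

(** Neighbours of [a] are at least [a - 21], so every list consulted belongs to a vertex from 11 on,
    where [chain_link_shift] applies. *)
Lemma locally_sound_shift m a : 33 <= a ->
  locally_sound m a -> locally_sound m.+1 (a + 11).
Proof.
move=> a33 /and3P[/allP lk ev lo]; apply/and3P; split.
- rewrite chain_link_shift; last by lia.
  apply/allP=> _ /mapP[b ab ->]; have /and5P[bm ba sab tab /andP[cab hab]] := lk b ab.
  have rb := chain_link_range ab.
  have ab' : next (chain_link m a) b \in chain_link m a by rewrite mem_next.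
  have rb' := chain_link_range ab'.
  have nmap x y : next (map (addn 11) (chain_link m x)) (11 + y)
    = 11 + next (chain_link m x) y by rewrite next_map ?undup_uniq //; exact: addnI.
  rewrite nmap ![11 + _]addnC !chain_link_shift; try lia.
  rewrite chain_colour_shift cab ![_ + 11]addnC mem_map; last exact: addnI.
  rewrite nmap sab (eqP tab) eqxx; lia.
- by rewrite chain_link_shift ?size_map //; lia.
- case/predU1P: lo => [|/hasP[b ab ltba]]; first by lia.
  apply/orP; right; apply/hasP; exists (11 + b); last by rewrite addnC /= ltn_add2r.
  by rewrite chain_link_shift ?map_f //; lia.
Qed.

Lemma locally_sound_widen m a : a + 13 < 11 * m ->
  locally_sound m a -> locally_sound m.+1 a.
Proof.
move=> am; rewrite /locally_sound chain_link_widen; last by lia.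
case/andP=> /allP lk ->; rewrite andbT; apply/allP=> b ab.
have /and5P[bm ba sab tab /andP[cab hab]] := lk b ab.
have rb := chain_link_range ab.
have ab' : next (chain_link m a) b \in chain_link m a by rewrite mem_next.
have rb' := chain_link_range ab'.
rewrite !chain_link_widen; lia.
Qed.

(* Away from its ends the chain is invariant under translation by 11, which
   reduces its local properties to a computation in the chain of length 6. *)
Lemma chain_locally_sound m a : 6 <= m -> a < 11 * m + 3 -> locally_sound m a.
Proof.
move=> m6; rewrite -(subnK m6); elim: (m - 6) a => [|n IHn] a.
  have /allP/(_ a) : all (locally_sound 6) (iota 0 69) by vm_compute.
  by rewrite mem_iota.
(* Below 44, [a + 13 < 66] allows widening; from 44 on, [a - 11 >= 33] allows translation. *)
rewrite addSn => am; have [a44|a44] := ltnP a 44.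
  by apply: locally_sound_widen; [lia | apply: IHn; lia].
rewrite (_ : a = a - 11 + 11); last by lia.
by apply: locally_sound_shift; [lia | apply: IHn; lia].
Qed.

(** The total is 6 V - 12 for V = 11 m + 3. A longer chain has one more period of eleven vertices,
    whose total 66 is carried through the induction. *)
Lemma chain_link_total m : 1 < m ->
  \sum_(0 <= a < 11 * m + 3) size (chain_link m a) = 66 * m + 6.
Proof.
move=> m2; suff [] : \sum_(0 <= a < 11 * m + 3) size (chain_link m a) = 66 * m + 6
  /\ \sum_(11 <= a < 22) size (chain_link m a) = 66 by [].
rewrite -(subnK m2); elim: (m - 2) => [|n [IHn IHn']].
  by split; rewrite unlock; vm_compute.
rewrite addSn; move: IHn IHn'; set m' := n + 2 => IHn IHn'.
have widen i : \sum_(i <= a < 22) size (chain_link m'.+1 a)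
             = \sum_(i <= a < 22) size (chain_link m' a).
  by apply: eq_big_nat => a a22; rewrite chain_link_widen //; lia.
split; last by rewrite widen.
rewrite (@big_cat_nat _ _ _ 22) /=; [|lia|lia].
rewrite widen (@big_addn _ _ _ 11 _ 11).
rewrite (_ : _ - 11 = 11 * m' + 3); last by lia.
rewrite (@eq_big_nat _ _ _ 11 _ _ (fun a => size (chain_link m' a))); last first.
  by move=> a a11; rewrite chain_link_shift ?size_map //; lia.
rewrite (@big_cat_nat _ _ _ 11) //= in IHn; last by lia.
rewrite (@big_cat_nat _ _ _ 11) //= IHn'; lia.
Qed.

(* The darts of the two faces of a copy which may not be faces of the chain. *)
Definition rim := [:: (0, 1); (1, 2); (2, 0); (11, 13); (13, 12); (12, 11)].

(** Copy [i] is an induced subgraph of the chain, and its faces off [rim] are faces of the chain. *)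
Definition gadget_sound m i := all (fun j => all (fun j' =>
   ((11 * i + j' \in chain_link m (11 * i + j)) == (j' \in link j)) &&
   ((j' \in link j) && ((j, j') \notin rim)
    ==> (next (chain_link m (11 * i + j')) (11 * i + j) == 11 * i + next (link j') j)))
  (iota 0 14)) (iota 0 14).

Lemma chain_gadget_sound m i : 6 <= m -> i < m -> gadget_sound m i.
Proof.
move=> m6; rewrite -(subnK m6); elim: (m - 6) i => [|n IHn] i.
  have /allP/(_ i) : all (gadget_sound 6) (iota 0 6) by vm_compute.
  by rewrite mem_iota.
rewrite addSn; set m' := n + 6 => im; have [i2|i2] := ltnP i 2.
  have := IHn i; rewrite /gadget_sound => /(_ _)/allP gs; apply/allP=> j j14.
  have /allP gsj := gs ltac:(lia) j j14; apply/allP => j' j14'.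
  move: (gsj j' j14'); rewrite !mem_iota in j14 j14' *.
  by rewrite !chain_link_widen //; lia.
have [i' Ei] : exists i', i = i'.+1 by exists i.-1; lia.
have := IHn i'; rewrite /gadget_sound => /(_ _)/allP gs; apply/allP=> j j14.
have /allP gsj := gs ltac:(lia) j j14; apply/allP => j' j14'.
have E k : 11 * i + k = 11 + (11 * i' + k) by lia.
move: (gsj j' j14'); rewrite !E ![11 + (11 * i' + _)]addnC.
rewrite !chain_link_shift; try lia.
rewrite ![_ + 11]addnC next_map ?undup_uniq //; try exact: addnI.
by rewrite mem_map ?eqn_add2l //; exact: addnI.
Qed.

(** * Permeating subtrees in one copy *)

(* The faces and the Petrie hexagons of the cube, then hexagons through three
   poles, then triangles: enough to meet every hitting connected candidate that
   [tetrakis_obstructed] examines. *)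
Definition tetrakis_cycles : seq (seq nat) :=
  [:: [:: 1; 2; 11; 3]; [:: 1; 2; 4; 6]; [:: 1; 3; 5; 6]; [:: 4; 6; 5; 12];
      [:: 2; 4; 12; 11]; [:: 3; 5; 12; 11];
      [:: 2; 4; 6; 5; 3; 11]; [:: 1; 2; 4; 12; 5; 3];
      [:: 1; 3; 11; 12; 4; 6]; [:: 1; 2; 11; 12; 5; 6];
      [:: 0; 1; 10; 5; 8; 4]; [:: 0; 2; 7; 3; 10; 6]; [:: 0; 1; 7; 11; 9; 4];
      [:: 1; 7; 11; 13; 5; 10]; [:: 4; 8; 5; 13; 11; 9];
      [:: 2; 7; 3; 13; 12; 9]; [:: 0; 2; 9; 12; 8; 6]; [:: 3; 10; 6; 8; 12; 13];
      [:: 1; 3; 7]; [:: 0; 2; 4]; [:: 0; 1; 2]; [:: 3; 5; 13]; [:: 0; 4; 6];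
      [:: 5; 6; 10]; [:: 3; 7; 11]; [:: 2; 9; 11]; [:: 0; 1; 6]; [:: 4; 9; 12];
      [:: 5; 12; 13]; [:: 9; 11; 12]].

Definition misses_face (S : seq nat) := has (fun v => has (fun u =>
    [&& (u, v) \notin rim, u \notin S, v \notin S & next (link v) u \notin S])
  (link v)) (iota 0 14).

(* The connected component of the first vertex of S. *)
Definition component (S : seq nat) :=
  iter 14 (fun C => [seq v <- S | (v \in C) || has (mem C) (link v)]) (take 1 S).

(** The test itself certifies that [C] is a closed part of [S], neither empty nor everything, so
    nothing has to be proved about [component]. *)
Definition splits (S : seq nat) :=
  let C := component S in
  [&& has (mem C) S, ~~ all (mem C) S &
      all (fun v => has (mem C) (link v) ==> (v \in C)) S].

Definition obstructed S :=
  [|| misses_face S, has (all (mem S)) tetrakis_cycles | splits S].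

Fixpoint subseqs (s : seq nat) :=
  if s is x :: s' then map (cons x) (subseqs s') ++ subseqs s' else [:: [::]].

Lemma filter_subseqs (p : pred nat) s : filter p s \in subseqs s.
Proof.
elim: s => //= x s IHs; rewrite mem_cat; case: (p x); rewrite ?IHs ?orbT //.
by rewrite map_f.
Qed.

Definition poles := [:: 0; 7; 8; 9; 10; 13].
Definition corners := [:: 1; 2; 3; 4; 5; 6; 11; 12].

(* The two counting arguments become an enumeration of the sets of corners. *)
Lemma tetrakis_obstructed :
  all (fun S => obstructed S && obstructed (poles ++ S)) (subseqs corners).
Proof. by vm_compute. Qed.

(** The stride 6 is a multiple of 3, the period of the colour rotation, and keeps the chosen copies
    disjoint. *)
Lemma pole_colour t x j : x < 3 -> j \in poles ->
  chain_colour (11 * (6 * t + x) + j) = x.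
Proof.
move=> x3; rewrite /chain_colour [11 * _]mulnC modnMDl divnMDl // !inE.
by case/or4P=> [|||/or3P[]] /eqP-> /=; lia.
Qed.

Lemma tetrakis_cyclesP c : c \in tetrakis_cycles ->
  [/\ path.cycle (fun u v => v \in link u) c, uniq c, 2 < size c & all (gtn 14) c].
Proof.
pose ok c := [&& path.cycle (fun u v => v \in link u) c, uniq c,
                 2 < size c & all (gtn 14) c].
have /allP tet : all ok tetrakis_cycles by vm_compute.
by move/tet/and4P.
Qed.

(** * The chain as a 3-coloured Eulerian planar triangulation *)

Section Chain.
Variable m : nat.
Hypothesis m6 : 6 <= m.
Local Notation vertex := 'I_(11 * m).+3.

Definition chain_nb (a : vertex) : seq vertex := map inord (chain_link m a).

Lemma chain_linkP (a b : nat) : a < 11 * m + 3 -> b \in chain_link m a ->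
  [/\ b < 11 * m + 3, b != a, a \in chain_link m b,
      next (chain_link m (next (chain_link m a) b)) a = b &
      chain_colour b != chain_colour a /\ b < 11 * (a %/ 11) + 14].
Proof.
move=> am ab; have /and3P[/allP/(_ b ab)] := chain_locally_sound m6 am.
by case/and5P=> ? ? ? /eqP ? /andP[].
Qed.

Lemma val_chain_nb (a : vertex) : map val (chain_nb a) = chain_link m a.
Proof.
rewrite -map_comp map_id_in // => b ab /=; rewrite inordK //.
have [] := chain_linkP _ ab; have := ltn_ord a; lia.
Qed.

Lemma mem_chain_nb (a b : vertex) : (b \in chain_nb a) = (val b \in chain_link m a).
Proof. by rewrite -val_chain_nb mem_map //; exact: val_inj. Qed.

Lemma chain_nb_uniq a : uniq (chain_nb a).
Proof. by rewrite -(map_inj_uniq val_inj) val_chain_nb undup_uniq. Qed.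

Lemma val_next_chain_nb (a b : vertex) :
  val (next (chain_nb a) b) = next (chain_link m a) b.
Proof.
by rewrite -val_chain_nb (next_map val_inj) ?chain_nb_uniq.
Qed.

Lemma vertex_lt (a : vertex) : a < 11 * m + 3.
Proof. by rewrite addn3. Qed.

Lemma chain_nb_sym a b : b \in chain_nb a -> a \in chain_nb b.
Proof. by rewrite !mem_chain_nb => /(chain_linkP (vertex_lt a))[]. Qed.

Lemma chain_nb_irr a : a \notin chain_nb a.
Proof.
apply/negP; rewrite mem_chain_nb => /(chain_linkP (vertex_lt a))[_].
by rewrite eqxx.
Qed.

Lemma chain_nb_tri a b : b \in chain_nb a ->
  next (chain_nb (next (chain_nb a) b)) a = b.
Proof.
rewrite mem_chain_nb => /(chain_linkP (vertex_lt a))[_ _ _ E _].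
by apply: val_inj; rewrite !val_next_chain_nb.
Qed.

Definition chain_graph := list_graph chain_nb_sym chain_nb_irr.
Local Notation G := chain_graph.
Definition chain_rotation : {perm dart G} :=
  list_rotation chain_nb_uniq chain_nb_sym chain_nb_irr.

Lemma chain_connect (a b : vertex) : connect (@adj G) a b.
Proof.
suff to0 c : connect (@adj G) c ord0.
  by apply: connect_trans (to0 a) _; rewrite (sym_connect_sym (@adj_sym G)) to0.
have [n] := ubnP (val c); elim: n c => // n IHn c cn.
have /and3P[_ _] := chain_locally_sound m6 (vertex_lt c).
case/predU1P=> [c0|/hasP[x cx /= ltxc]].
  by rewrite (_ : c = ord0) //; exact: val_inj.
have xE : (inord x : vertex) = x :> nat by rewrite inordK //; have := ltn_ord c; lia.
apply: (@connect_trans _ _ (inord x : vertex)).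
  by apply: connect1; rewrite /= mem_chain_nb [val _]xE.
by apply: IHn; rewrite [val _]xE; exact: leq_trans ltxc cn.
Qed.

Lemma chain_plane : plane_embedding chain_rotation.
Proof.
apply: list_plane_embedding; [exact: chain_nb_tri | exact: chain_connect |].
rewrite card_ord (eq_bigr (fun a : vertex => size (chain_link m a))); last first.
  by move=> a _; rewrite size_map.
rewrite -(big_mkord xpredT (fun a => size (chain_link m a))) -addn3.
by rewrite chain_link_total; lia.
Qed.

Lemma chain_triangular F : F \in faces chain_rotation -> bounded_by_3cycle F.
Proof. exact/list_faces_triangular/chain_nb_tri. Qed.

Lemma chain_card : 4 <= #|G|.
Proof. by rewrite card_ord; lia. Qed.

Definition chain : planar_triangulation :=
  PlanarTriangulation chain_card chain_plane chain_triangular.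

Definition number (a : chain) : nat := (a : vertex).

Lemma number_inj : injective number.
Proof. exact: val_inj. Qed.

Lemma number_lt a : number a < 11 * m + 3.
Proof. exact: vertex_lt. Qed.

Lemma adj_number u v : adj u v = (number v \in chain_link m (number u)).
Proof. exact: mem_chain_nb. Qed.

Lemma chain_eulerian : eulerian chain.
Proof.
move=> v; have /and3P[_ + _] := chain_locally_sound m6 (vertex_lt v).
rewrite -val_chain_nb size_map -(card_uniqP (chain_nb_uniq v)).
by congr (~~ odd _); apply: eq_card => u; rewrite !inE.
Qed.

Lemma chain_colour_lt a : chain_colour a < 3.
Proof. exact: ltn_mod. Qed.

Definition chain_col (a : chain) : 'I_3 := Ordinal (chain_colour_lt (number a)).

Lemma chain_col_proper : proper_colouring chain_col.
Proof.
move=> u v; rewrite adj_number => /(chain_linkP (number_lt u))[_ _ _ _ [+ _]].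
by rewrite eq_sym.
Qed.

(** * The trace of a permeating subtree on one copy *)

Section Gadget.
Variable T : subgraph chain.
Hypothesis perm_T : permeating_subtree T.
Variable i : nat.
Hypothesis im : i < m.

Definition gadget_vertex j : chain := (inord (11 * i + j) : vertex).

Lemma gadget_vertexK j : j < 14 -> number (gadget_vertex j) = 11 * i + j.
Proof. by move=> j14; apply: (@inordK (11 * m).+2); lia. Qed.

Lemma gadget_soundP j j' : j < 14 -> j' < 14 ->
  (11 * i + j' \in chain_link m (11 * i + j)) = (j' \in link j) /\
  (j' \in link j -> (j, j') \notin rim ->
  next (chain_link m (11 * i + j')) (11 * i + j) = 11 * i + next (link j') j).
Proof.
move=> j14 j14'; have /allP/(_ j) := chain_gadget_sound m6 im.
rewrite mem_iota => /(_ j14)/allP/(_ j'); rewrite mem_iota => /(_ j14').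
by case/andP=> /eqP -> H; split=> // jj' njj'; move: H; rewrite jj' njj' => /eqP.
Qed.

Lemma gadget_adj j j' : j < 14 -> j' < 14 ->
  adj (gadget_vertex j) (gadget_vertex j') = (j' \in link j).
Proof.
move=> j14 j14'; rewrite adj_number !gadget_vertexK //.
by case: (gadget_soundP j14 j14').
Qed.

Lemma sadjE u v : u \in sverts T -> v \in sverts T -> sadj T u v = adj u v.
Proof.
move=> uT vT; apply/idP/idP => [/sadj_sub/and3P[]//|]; exact: perm_T.1.1.
Qed.

Lemma face_hit (u v : chain) : adj u v ->
  [|| u \in sverts T, v \in sverts T |
      (next (chain_nb v) u : chain) \in sverts T].
Proof.
move=> uv; pose d : dart chain := exist _ (u, v) uv.
have F_d : porbit (rev_perm G * chain_rotation)%g d \in faces (rotation chain).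
  exact: imset_f.
have [w wT /(incident_face chain_nb_tri)] := perm_T.1.2 _ F_d.
rewrite !inE => /or3P[] /eqP Ew; rewrite {}Ew in wT; apply/or3P.
- exact: Or31.
- exact: Or32.
- exact: Or33.
Qed.

Variable S : seq nat.
Hypothesis S14 : all (gtn 14) S.
Hypothesis ST : forall j, j < 14 -> (j \in S) = (gadget_vertex j \in sverts T).

Lemma gadget_hits_faces : ~~ misses_face S.
Proof.
apply/hasPn=> v; rewrite mem_iota => v14; apply/hasPn=> u uv.
have u14 := link_lt14 uv; apply/negP=> /and4P[nr].
have vu : v \in link u.
  rewrite -(gadget_soundP u14 v14).1; move: uv; rewrite -(gadget_soundP v14 u14).1.
  by move/chain_linkP=> -[]; lia.
have w14 : next (link v) u < 14 by apply: (@link_lt14 v); rewrite mem_next.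
rewrite !ST // => /negbTE nu /negbTE nv /negbTE nw.
have := @face_hit (gadget_vertex u) (gadget_vertex v).
rewrite gadget_adj // vu nu nv => /(_ isT) /=.
suff -> : next (chain_nb (gadget_vertex v)) (gadget_vertex u) =
    gadget_vertex (next (link v) u) by rewrite nw.
apply: number_inj; rewrite [LHS]val_next_chain_nb -!/(number _) !gadget_vertexK //.
exact: (gadget_soundP u14 v14).2.
Qed.

(** [T] is induced, so a listed cycle with all its vertices in [S] would be a cycle of [T] of length
    at least 3. *)
Lemma gadget_acyclic : ~~ has (all (mem S)) tetrakis_cycles.
Proof.
apply/hasPn=> c /tetrakis_cyclesP[cc uc sc c14]; apply/negP=> /allP cS.
have := perm_T.2.2 (map gadget_vertex c); rewrite size_map leqNgt sc.
move=> H; apply/notF/H/andP; split; last first.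
  rewrite map_inj_in_uniq // => j j' /(allP c14) /= jl /(allP c14) /= jl'.
  by move/(congr1 number); rewrite !gadget_vertexK // => /addnI.
rewrite cycle_map; apply: (@sub_in_cycle _ (mem c) _ _ _ _ _ cc); last exact/allP.
move=> j j' jc j'c /= jj'; have [/= j14 j14'] := (allP c14 _ jc, allP c14 _ j'c).
by rewrite sadjE -?ST ?gadget_adj //; apply: cS.
Qed.

Definition lower (C : seq nat) := has (mem C) [:: 0; 1; 2].
Definition upper (C : seq nat) := has (mem C) [:: 11; 12; 13].

(** An edge cannot jump over the triangle [11 * q], [11 * q + 1], [11 * q + 2], which therefore
    separates the chain. *)
Lemma adj_cut q (u v : chain) :
  number u < 11 * q -> adj u v -> number v < 11 * q + 3.
Proof.
by move=> uq; rewrite adj_number => /(chain_linkP (number_lt u))[_ _ _ _ [_]]; lia.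
Qed.

Lemma adj_below (u v : chain) :
  adj u v -> number u < 11 * i -> number v < 11 * i + 3.
Proof. by move=> uv ui; exact: adj_cut ui uv. Qed.

Lemma adj_above (u v : chain) :
  adj u v -> 11 * i + 14 <= number u -> 11 * i + 11 <= number v.
Proof.
by move=> uv ui; have := @adj_cut i.+1 v u; rewrite adj_sym uv => /(_ _ isT); lia.
Qed.

Lemma in_lower (C : seq nat) j : j \in C -> j < 3 -> lower C.
Proof. by move=> jC; do 3?[case: j jC => [|j] jC]; rewrite /lower /= ?jC ?orbT. Qed.

Lemma in_upper (C : seq nat) j : j \in C -> 11 <= j < 14 -> upper C.
Proof. by move=> jC j11; apply/hasP; exists j; rewrite // !inE; lia. Qed.

Variant gadget_spec (u : chain) : Prop :=
  | Below of number u < 11 * i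
  | Above of 11 * i + 14 <= number u
  | Inside j of j < 14 & u = gadget_vertex j.

Lemma gadgetP u : gadget_spec u.
Proof.
have [|ui] := ltnP (number u) (11 * i); first exact: Below.
have [|ui'] := leqP (11 * i + 14) (number u); first exact: Above.
have ji : number u - 11 * i < 14 by lia.
by apply: Inside ji _; apply: number_inj; rewrite gadget_vertexK; lia.
Qed.

(* A component C of S is extended by everything below (above) the copy if it
   contains a vertex of the lower (upper) triangle: this is closed in T, since
   the vertices of S in one triangle are adjacent to each other. *)
Lemma gadget_connected : ~~ splits S.
Proof.
apply/negP=> /and3P[/hasP[s sS /= sC] /allPn[s' s'S /= s'C] /allP closed].
set C := component S in sC s'C closed.
have Cclosed j j' : j \in C -> j' \in S -> j \in link j' -> j' \in C.
  by move=> jC /closed/implyP H jj'; apply/H/hasP; exists j.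
have lowC j : j \in S -> j < 3 -> lower C -> j \in C.
  move=> jS j3 /hasP[c c3 /= cC]; have [<-//|cj] := eqVneq c j.
  apply: (Cclosed c) => //; move: j j3 c c3 cj {jS cC}.
  by do 3?[case=> //]; move=> _ c; rewrite !inE => /or3P[] /eqP ->.
have uppC j : j \in S -> 11 <= j < 14 -> upper C -> j \in C.
  move=> jS j3 /hasP[c c3 /= cC]; have [<-//|cj] := eqVneq c j.
  apply: (Cclosed c) => //; move: j j3 c c3 cj {jS cC}.
  by do 14?[case=> //]; move=> _ c; rewrite !inE => /or3P[] /eqP ->.
pose inC (u : chain) := let a := number u in
  if a < 11 * i then lower C else if 11 * i + 14 <= a then upper C
  else a - 11 * i \in C.
have inC_below u : number u < 11 * i -> inC u = lower C by rewrite /inC => ->.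
have inC_above u : 11 * i + 14 <= number u -> inC u = upper C.
  by rewrite /inC => ui; rewrite ui ltnNge (leq_trans _ ui) ?leq_addr.
have inCE j : j < 14 -> inC (gadget_vertex j) = (j \in C).
  move=> j14; rewrite /inC gadget_vertexK // addKn.
  by rewrite leq_add2l [14 <= j]leqNgt j14 ltnNge leq_addr.
have /intro_closed clC : forall u v : chain, sadj T u v -> u \in inC -> v \in inC.
  move=> u v uv; have /and3P[uT vT auv] := sadj_sub uv.
  have avu : adj v u by rewrite adj_sym.
  rewrite -![_ \in inC]/(inC _).
  (* No edge joins the part below to the part above, and an edge leaving the copy has its inner end
     in the lower or upper triangle. *)
  have [ui|ui|j j14 Eu] := gadgetP u; have [vi|vi|j' j14' Ev] := gadgetP v;
    rewrite ?(inC_below _ ui) ?(inC_above _ ui) ?(inC_below _ vi) ?(inC_above _ vi) //.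
  - by have := adj_below auv ui; clear -vi; lia.
  - rewrite Ev inCE //; apply: lowC; first by rewrite ST -?Ev.
    by have := adj_below auv ui; rewrite Ev gadget_vertexK // ltn_add2l.
  - by have := adj_below avu vi; clear -ui; lia.
  - rewrite Ev inCE //; apply: uppC; first by rewrite ST -?Ev.
    by have := adj_above auv ui; rewrite Ev gadget_vertexK // leq_add2l j14' andbT.
  - rewrite Eu inCE // => /in_lower; apply.
    by have := adj_below avu vi; rewrite Eu gadget_vertexK // ltn_add2l.
  - rewrite Eu inCE // => /in_upper; apply.
    by have := adj_above avu vi; rewrite Eu gadget_vertexK // leq_add2l j14 andbT.
  - rewrite Eu Ev !inCE // => jC; apply: Cclosed jC _ _; first by rewrite ST -?Ev.
    by rewrite -gadget_adj // -Eu -Ev.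
have s14 : s < 14 by exact: (allP S14).
have s'14 : s' < 14 by exact: (allP S14).
have := perm_T.2.1.2 (gadget_vertex s) (gadget_vertex s').
rewrite -!ST // => /(_ sS s'S)/(closed_connect (clC (sym_connect_sym (@sadj_sym _ T)))).
by rewrite -![_ \in inC]/(inC _) !inCE // sC (negbTE s'C).
Qed.

Lemma gadget_not_obstructed : ~~ obstructed S.
Proof.
rewrite /obstructed; apply/or3P=> -[].
- exact/negP/gadget_hits_faces.
- exact/negP/gadget_acyclic.
- exact/negP/gadget_connected.
Qed.
End Gadget.

Lemma pole_or_corner j : j < 14 -> (j \in poles) = (j \notin corners).
Proof. by do 14![case: j => [//|j]]. Qed.

(** If [T] had no pole of the copy, its trace would be a set of corners; if it had all of them, the
    poles and a set of corners. The enumeration excludes both. *)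
Lemma gadget_poles (T : subgraph chain) i : permeating_subtree T -> i < m ->
  (exists2 j, j \in poles & gadget_vertex i j \in sverts T) /\
  (exists2 j, j \in poles & gadget_vertex i j \notin sverts T).
Proof.
move=> pT im; pose inT j := gadget_vertex i j \in sverts T.
have /allP/(_ _ (filter_subseqs inT corners))/andP[ob ob'] := tetrakis_obstructed.
have corners14 : all (gtn 14) (filter inT corners).
  by apply/allP=> j; rewrite mem_filter => /andP[_]; move: j; exact/allP.
split; apply/hasP; apply: contraT => /hasPn no.
- have ST j : j < 14 -> (j \in filter inT corners) = inT j.
    move=> j14; rewrite mem_filter andbC; have := pole_or_corner j14.
    by case: (j \in corners) => //= /no/negbTE.
  by have := gadget_not_obstructed pT im corners14 ST; rewrite ob.
have S14 : all (gtn 14) (poles ++ filter inT corners) by rewrite all_cat corners14.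
have ST j : j < 14 -> (j \in poles ++ filter inT corners) = inT j.
  move=> j14; rewrite mem_cat mem_filter andbC; have := pole_or_corner j14.
  by case: (j \in corners) => [->//|/[dup] /no /negPn inTj ->]; rewrite /inT inTj.
by have := gadget_not_obstructed pT im S14 ST; rewrite ob'.
Qed.
End Chain.

Theorem theorem4 (k : int) :
  exists G : planar_triangulation,
    eulerian G /\
    exists col : G -> 'I_3,
      proper_colouring col /\
      forall T : subgraph G, permeating_subtree T ->
      forall i : 'I_3,
        (k <= #|colour_class col i :&: sverts T|%:Z)%R /\
        (k <= #|colour_class col i :\: sverts T|%:Z)%R.
Proof.
(* Since [k <= n], negative [k] included, [n] witnesses suffice. The length [m] leaves room for the
   copies [6 * t + x] with [t < n], and is at least 6 even for [n = 0]. *)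
pose n := `|k|%N; pose m := 6 * n + 6; have m6 : 6 <= m by lia.
exists (chain m6); split; first exact: chain_eulerian.
exists (@chain_col m m6); split; first exact: chain_col_proper.
move=> T pT x.
pose G := chain m6; pose pole t j : G := gadget_vertex m6 (6 * t + x) j.
have x3 := ltn_ord x; have lt_m (t : 'I_n) : 6 * t + x < m by have := ltn_ord t; lia.
have pole14 j : j \in poles -> j < 14 by exact: (allP (isT : all (gtn 14) poles)).
have many (A : {set G}) : (forall t : 'I_n, exists2 j, j \in poles & pole t j \in A) ->
    (k <= #|A|%:Z)%R.
  move=> /fin_all_exists2[j jp jA]; suff : n <= #|A| by lia.
  (* Poles of different chosen copies differ: the copies start at least 66 apart and offsets are
     below 14. *)
  have inj_pole : injective (fun t : 'I_n => pole t (j t)).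
    move=> t t' /(congr1 (@number m m6)).
    rewrite !gadget_vertexK ?pole14 //= => E; apply: val_inj => /=.
    have := pole14 _ (jp t); have := pole14 _ (jp t'); lia.
  rewrite -[n]card_ord -(card_imset _ inj_pole); apply/subset_leq_card/subsetP.
  by move=> _ /imsetP[t _ ->].
have pole_col (t : 'I_n) j : j \in poles -> pole t j \in colour_class (@chain_col m m6) x.
  move=> jp; rewrite inE; apply/eqP/val_inj => /=.
  by rewrite -/(number _) gadget_vertexK ?pole14 // pole_colour.
split; apply: many => t; have [[j jp jT] [j' jp' jT']] := gadget_poles pT (lt_m t).
  by exists j; rewrite // in_setI pole_col.
by exists j'; rewrite // in_setD pole_col // andbT.
Qed.
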